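(* Let $n\geq 3$ be an integer, let $q_n=x_1^2+\cdots+x_n^2$ and $T_{n,2}=\binom{n+1}{2}$. Then: (1) if $n\in\{3,7,23\}$, then $\operatorname{rk}(q_n^2)=T_{n,2}$; (2) if $n=8$, then $T_{n,2}+1\leq\operatorname{rk}(q_n^2)\leq T_{n,2}+9$; (3) if $n>23$ and $n=m^2-2$ for some odd number $m\in\mathbb{N}$, then $T_{n,2}\leq\operatorname{rk}(q_n^2)\leq T_{n,2}+1$; (4) otherwise, $\operatorname{rk}(q_n^2)=T_{n,2}+1$.
   Context: For a homogeneous polynomial $f\in\mathbb{C}[x_1,\dots,x_n]$ of degree $d$, the (complex) Waring rank $\operatorname{rk}(f)$ is the minimum $r\in\mathbb{N}$ such that $f=\sum_{j=1}^r\ell_j^d$ for some linear forms $\ell_1,\dots,\ell_r$ with complex coefficients. *)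

(* Defs.v *)
From mathcomp Require Import all_boot all_order all_algebra.
From mathcomp Require Import mpoly complex.
From mathcomp Require Import reals.

Set Implicit Arguments.
Unset Strict Implicit.
Unset Printing Implicit Defensive.

Import GRing.Theory.
Local Open Scope ring_scope.

(* As usual for [.-homog], the zero polynomial counts as a linear form. *)
Definition has_waring_decomp (K : comNzRingType) (n d : nat)
    (f : {mpoly K[n]}) (r : nat) : Prop :=
  exists l : 'I_r -> {mpoly K[n]},
    (forall j : 'I_r, l j \is 1.-homog) /\ f = \sum_(j < r) l j ^+ d.

(* The rank as a relation: [is_waring_rank d f r] means rk(f) = r, where f is
   a form of degree d. *)
Definition is_waring_rank (K : comNzRingType) (n d : nat)
    (f : {mpoly K[n]}) (r : nat) : Prop :=
  has_waring_decomp d f r /\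
  (forall s : nat, has_waring_decomp d f s -> (r <= s)%N).

Definition quad_form (K : comNzRingType) (n : nat) : {mpoly K[n]} :=
  \sum_(i < n) 'X_i ^+ 2.

(* Main.v *)
Require Import Defs.
From mathcomp Require Import all_boot all_order all_algebra.
From mathcomp Require Import mpoly complex.
From mathcomp Require Import reals.
From mathcomp Require Import boolp.
From mathcomp Require Import ring zify.

Set Implicit Arguments.
Unset Strict Implicit.
Unset Printing Implicit Defensive.

Import Order.TTheory GRing.Theory Num.Theory.
Local Open Scope ring_scope.

(** Write q for x_1^2 + ... + x_n^2, a.b for the standard bilinear form, N(a)
for a.a, T for n(n+1)/2, and identify a linear form with its coefficient
vector.

A decomposition of q^2 as the sum of the (a_t.x)^4 says that the a_t have the
fourth moments of a spherical design.  Consequently the kernel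
(3/2) ((a_t.a_u)^2 - N(a_t) N(a_u) / (n+2)), which is the Gram matrix of the
quadrics (a_t.x)^2 for a suitable form on the space of quadrics, is an
idempotent matrix of trace T.  In characteristic zero the trace of an idempotent
is its rank, so a decomposition has at least T terms ([binomial_le_size]), and
when it has exactly T terms the kernel is the identity
([tight_veronese_kernel]).

In the latter case all N(a_t)^2 agree and (a_t.a_u)^2 = N(a_t) N(a_u) / (n+2).
Multiplying some a_t by a square root of -1 changes no fourth power and makes
the N(a_t) themselves agree, so that after scaling by mu = sqrt (n+2) the Gram
matrix is mu I + S with S symmetric, zero on the diagonal and +1 or -1
elsewhere.  It is also a multiple of an idempotent, and comparing one
off-diagonal entry of its square makes mu (n-3) an integer: either n = 3 or mu is
an integer.  An even mu is impossible, because then n is even and mu I + S is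
congruent to J - I modulo 2, whose principal minors of size n+2 are odd, whereas
the Gram matrix has rank at most n.  Hence n = mu^2 - 2 with mu odd ([tight_dim]).

For the upper bounds, one looks for decompositions invariant under permuting the
variables, made of the forms x_i + x_j + c s, x_i + b s and s, where s is the
sum of the variables.  Comparing coefficients of power-sum monomials
([symmetric_identity]) leaves a quadratic equation for c, provided that n
is not 8, and gives T + 1 terms ([quartic_generic]).  For n = 7 the last term
drops out and T terms remain; for n = 8 the coefficient of the fourth power sum
degenerates and a second family x_i + b' s repairs it, at the cost of n more
terms.  For n = 3 the six diagonals of the icosahedron work.

For n = 23, the tightness criterion is reversed: T equiangular vectors with the
angle above decompose q^2 once suitably rescaled ([equiangular_decomp]), because their squares form a
basis of the quadrics with an explicit dual basis.  The 276 vectors come from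
the 253 blocks of the Witt design S(4,7,23) and the 23 points: two blocks meet
in 1 or 3 points, and shifting all coordinates of a vector by a constant, one
for the points and one for the blocks, turns every squared cosine into 1/25. *)

(** * Idempotents and their traces *)

(** In a full-rank factorization E = C R of an idempotent, R C is the identity
of size rank E, and tr (C R) = tr (R C). *)
Lemma mxtrace_idempotent (K : fieldType) m (E : 'M[K]_m) :
  E *m E = E -> \tr E = (\rank E)%:R.
Proof.
move=> EE; rewrite -{1}(mulmx_base E) mxtrace_mulC.
suff -> : row_base E *m col_base E = 1%:M by rewrite mxtrace1.
apply: (row_free_inj (row_base_free E)).
apply: (row_full_inj (col_base_full E)).
by rewrite /= mul1mx mulmx_base 2!mulmxA mulmx_base -mulmxA mulmx_base.
Qed.

(** Stated for kernels on an arbitrary finite type so that it applies both to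
matrices indexed by the forms of a decomposition and to operators on tensors,
indexed by pairs of coordinates. *)
Lemma kernel_trace_rank (K : fieldType) (I : finType) (f : I -> I -> K) :
  (forall p q, \sum_t f p t * f t q = f p q) ->
  exists r : nat, [/\ (r <= #|I|)%N, \sum_p f p p = r%:R &
                     r = 0%N -> forall p q, f p q = 0].
Proof.
move=> ff; pose E := \matrix_(i < #|I|, j < #|I|) f (enum_val i) (enum_val j).
have EE : E *m E = E.
  apply/matrixP => i j; rewrite !mxE -ff.
  rewrite [RHS](reindex (@enum_val I I)) /=; last exact/onW_bij/enum_val_bij.
  by apply: eq_bigr => k _; rewrite !mxE.
exists (\rank E); split; first exact: rank_leq_row.
  rewrite -mxtrace_idempotent // [LHS](reindex (@enum_val I I)) /=.
    by apply: eq_bigr => i _; rewrite mxE.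
  exact/onW_bij/enum_val_bij.
move/eqP; rewrite mxrank_eq0 => /eqP E0 p q.
have := congr1 (fun M : 'M_ _ => M (enum_rank p) (enum_rank q)) E0.
by rewrite !mxE !enum_rankK.
Qed.

(** * Linear forms as coefficient vectors *)
Definition dot (K : comNzRingType) n (x y : 'I_n -> K) : K :=
  \sum_i x i * y i.

Section Dot.
Variables (K : comNzRingType) (n : nat).
Implicit Types x y z : 'I_n -> K.

Lemma dotC x y : dot x y = dot y x.
Proof. by apply: eq_bigr => i _; rewrite mulrC. Qed.

Lemma dotDr x y z : dot x (fun i => y i + z i) = dot x y + dot x z.
Proof. by rewrite /dot -big_split; apply: eq_bigr => i _; rewrite mulrDr. Qed.

Lemma dotZr c x y : dot x (fun i => c * y i) = c * dot x y.
Proof. by rewrite /dot mulr_sumr; apply: eq_bigr => i _; rewrite mulrCA. Qed.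

Lemma dotDl x y z : dot (fun i => y i + z i) x = dot y x + dot z x.
Proof. by rewrite dotC dotDr !(dotC x). Qed.

Lemma dotZl c x y : dot (fun i => c * y i) x = c * dot y x.
Proof. by rewrite dotC dotZr dotC. Qed.

Lemma dot_unitr x i : dot x (fun j => (j == i)%:R) = x i.
Proof.
rewrite /dot (bigD1 i) //= eqxx mulr1 big1 ?addr0 // => j /negPf->.
by rewrite mulr0.
Qed.
End Dot.

Definition lform (K : comNzRingType) n (a : 'I_n -> K) : {mpoly K[n]} :=
  \sum_i a i *: 'X_i.

Lemma lform_homog (K : comNzRingType) n (a : 'I_n -> K) :
  lform a \is 1.-homog.
Proof. by apply: rpred_sum => i _; rewrite rpredZ // dhomogX /= mdeg1. Qed.

Lemma homog1_lform (K : comNzRingType) n (l : {mpoly K[n]}) :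
  l \is 1.-homog -> l = lform (fun i => l@_U_(i)).
Proof.
move=> hl; apply/mpolyP => m; rewrite linear_sum /=.
have [/mdeg1P[i /eqP ->] | m1] := boolP (mdeg m == 1%N).
  rewrite (bigD1 i) //= mcoeffZ mcoeffX eqxx mulr1 big1 ?addr0 // => j ji.
  by rewrite mcoeffZ mcoeffX eq_mnm1 (negPf ji) mulr0.
rewrite (dhomog_nemf_coeff hl) // big1 // => j _.
rewrite mcoeffZ mcoeffX; case: eqP => [jm|]; last by rewrite mulr0.
by rewrite -jm mdeg1 eqxx in m1.
Qed.

Lemma meval_lform (K : comNzRingType) n (a x : 'I_n -> K) :
  (lform a).@[x] = dot a x.
Proof.
by rewrite raddf_sum; apply: eq_bigr => i _; rewrite /= mevalZ mevalXU.
Qed.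

Lemma decomp_dot (K : comNzRingType) n s :
  has_waring_decomp 4 (quad_form K n ^+ 2) s ->
  exists a : 'I_s -> 'I_n -> K,
    forall x, dot x x ^+ 2 = \sum_t dot (a t) x ^+ 4.
Proof.
case=> l [hl q2]; exists (fun t i => (l t)@_U_(i)) => x.
have := congr1 (meval x) q2; rewrite rmorphXn /= /quad_form !raddf_sum /=.
under eq_bigr do rewrite rmorphXn /= mevalXU expr2.
move=> ->; apply: eq_bigr => t _.
by rewrite rmorphXn /= {1}(homog1_lform (hl t)) meval_lform.
Qed.

(** * The lower bound on the number of fourth powers *)
Section Moments.
Variables (K : numFieldType) (n s : nat) (a : 'I_s -> 'I_n -> K).
Hypothesis design : forall x, dot x x ^+ 2 = \sum_t dot (a t) x ^+ 4.
Local Notation nrm t := (dot (a t) (a t)).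

(** This is the part of the identity that is of degree 2 in each of x and y,
extracted by the second difference F(x+y) + F(x-y) - 2 F(x) - 2 F(y). *)
Lemma moment22 x y :
  3 * \sum_t dot (a t) x ^+ 2 * dot (a t) y ^+ 2 =
  dot x x * dot y y + 2 * dot x y ^+ 2.
Proof.
have twelve : (12 : K) != 0 by rewrite pnatr_eq0.
apply: (mulfI twelve).
have Dp := design (fun i => x i + y i).
have Dm := design (fun i => x i + -1 * y i).
have -> : 12 * (3 * \sum_t dot (a t) x ^+ 2 * dot (a t) y ^+ 2) =
   3 * (\sum_t dot (a t) (fun i => x i + y i) ^+ 4 +
   \sum_t dot (a t) (fun i => x i + -1 * y i) ^+ 4 -
   2 * (\sum_t dot (a t) x ^+ 4) - 2 * (\sum_t dot (a t) y ^+ 4)).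
  rewrite !mulr_sumr -!big_split /= -!sumrB mulr_sumr.
  by apply: eq_bigr => t _; rewrite !(dotDr, dotZr); ring.
rewrite -Dp -Dm -!design !(dotDl, dotDr, dotZl, dotZr) (dotC y x); ring.
Qed.

(** Sum [moment22] over y in the standard basis. *)
Lemma moment2_norm x : 3 * \sum_t dot (a t) x ^+ 2 * nrm t = n.+2%:R * dot x x.
Proof.
under eq_bigr do rewrite {2}/dot mulr_sumr.
rewrite exchange_big mulr_sumr /=.
under eq_bigr => i _.
  under eq_bigr do rewrite -expr2 -{1}(dot_unitr (a _) i).
  rewrite moment22 dot_unitr dot_unitr eqxx mulr1 expr2.
  over.
rewrite big_split /= sumr_const card_ord -mulr_sumr -/(dot x x).
by rewrite -mulr_natl; ring.
Qed.

(** Sum [moment2_norm] over x in the standard basis. *)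
Lemma moment_norm2 : 3 * \sum_t nrm t ^+ 2 = n.+2%:R * n%:R.
Proof.
under eq_bigr do rewrite expr2 {1}/dot mulr_suml.
rewrite exchange_big mulr_sumr /=.
under eq_bigr => i _.
  under eq_bigr do rewrite -expr2 -{1}(dot_unitr (a _) i).
  rewrite moment2_norm dot_unitr eqxx mulr1.
  over.
by rewrite sumr_const card_ord mulr_natr.
Qed.

Lemma moment2_norm_polar x y :
  3 * \sum_t nrm t * (dot (a t) x * dot (a t) y) = n.+2%:R * dot x y.
Proof.
have two : (2 : K) != 0 by rewrite pnatr_eq0.
apply: (mulfI two).
have := moment2_norm (fun i => x i + y i).
rewrite !(dotDl, dotDr) (dotC y x) => E.
have -> : 2 * (n.+2%:R * dot x y) =
    n.+2%:R * (dot x x + dot x y + (dot x y + dot y y))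
    - n.+2%:R * dot x x - n.+2%:R * dot y y by ring.
rewrite -E -!moment2_norm -!mulrBr mulrCA -!sumrB; congr (_ * _).
by rewrite mulr_sumr; apply: eq_bigr => t _; rewrite dotDr; ring.
Qed.

(** The Gram matrix of the quadrics (a_t.x)^2 for the form dual to
(A,B) -> (tr A tr B + 2 tr (A B)) / 3 on symmetric matrices; [moment22] says
that this form is the sum of the squares of the functionals A -> a_t A a_t. *)
Definition veronese_kernel (t u : 'I_s) : K :=
  3 / 2 * (dot (a t) (a u) ^+ 2 - nrm t * nrm u / n.+2%:R).

Lemma veronese_kernel_idem t u :
  \sum_v veronese_kernel t v * veronese_kernel v u = veronese_kernel t u.
Proof.
have three : (3 : K) != 0 by rewrite pnatr_eq0.
have E1 := moment22 (a t) (a u).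
have E2 := moment2_norm (a t); have E3 := moment2_norm (a u).
have E4 := moment_norm2.
apply: (mulfI three).
transitivity (9 / 4 * (3 * (\sum_v dot (a v) (a t) ^+ 2 * dot (a v) (a u) ^+ 2)
  - nrm u / n.+2%:R * (3 * \sum_v dot (a v) (a t) ^+ 2 * nrm v)
  - nrm t / n.+2%:R * (3 * \sum_v dot (a v) (a u) ^+ 2 * nrm v)
  + nrm t / n.+2%:R * (nrm u / n.+2%:R) * (3 * \sum_v nrm v ^+ 2))).
  rewrite !mulr_sumr -!sumrB -big_split /= mulr_sumr.
  apply: eq_bigr => v _; rewrite /veronese_kernel (dotC (a t) (a v)); field.
  by rewrite -natrD pnatr_eq0.
rewrite E1 E2 E3 E4 /veronese_kernel; field.
by rewrite -natrD pnatr_eq0.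
Qed.

Lemma veronese_kernel_trace : \sum_t veronese_kernel t t = ('C(n.+1, 2))%:R.
Proof.
have two : (2 : K) != 0 by rewrite pnatr_eq0.
apply: (mulfI two).
have -> : 2 * 'C(n.+1, 2)%:R = (n.+1%:R * n%:R) :> K.
  by rewrite -natrM bin2 mul2n -[X in X.*2]/(_./2) even_halfK ?natrM // oddM /= andNb.
have <- : n.+1%:R / n.+2%:R * (3 * \sum_t nrm t ^+ 2) = n.+1%:R * n%:R.
  by rewrite moment_norm2; field; rewrite -natrD pnatr_eq0.
rewrite !mulr_sumr; apply: eq_bigr => t _.
by rewrite /veronese_kernel; field; rewrite -natrD pnatr_eq0.
Qed.

Lemma binomial_le_size : ('C(n.+1, 2) <= s)%N.
Proof.
have [r [rs + _]] := kernel_trace_rank veronese_kernel_idem.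
by rewrite veronese_kernel_trace card_ord in rs * => /eqP; rewrite eqr_nat => /eqP->.
Qed.

(** The complementary idempotent has trace s - T = 0. *)
Lemma tight_veronese_kernel : s = 'C(n.+1, 2) ->
  forall t u, veronese_kernel t u = (t == u)%:R.
Proof.
move=> sT t u.
pose f t u := (t == u)%:R - veronese_kernel t u.
have ff p q : \sum_v f p v * f v q = f p q.
  under eq_bigr do rewrite /f mulrBl !mulrBr.
  rewrite !sumrB veronese_kernel_idem.
  rewrite (bigD1 p) //= eqxx mul1r big1 => [|v /negPf vp]; last first.
    by rewrite eq_sym vp mul0r.
  rewrite [X in _ - X - _](bigD1 p) //= eqxx mul1r big1 => [|v /negPf vp]; last first.
    by rewrite eq_sym vp mul0r.
  rewrite [X in _ - (X - _)](bigD1 q) //= eqxx mulr1 big1 => [|v /negPf vp]; last first.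
    by rewrite vp mulr0.
  by rewrite /f; ring.
have [r [_ tr f0]] := kernel_trace_rank ff.
apply/esym/eqP; rewrite -subr_eq0; apply/eqP/f0/eqP.
rewrite -(eqr_nat K) -tr /f sumrB veronese_kernel_trace -sT.
by under eq_bigr do rewrite eqxx; rewrite sumr_const card_ord subrr.
Qed.

End Moments.

(** * Tight decompositions *)

(** The squares N(a_t)^2 are all equal, so the N(a_t) agree up to sign; replacing
a_t by 'i a_t flips the sign of N(a_t) and preserves (a_t.x)^4. *)
Lemma normalized_tight (K : numClosedFieldType) n s (a : 'I_s -> 'I_n -> K) :
  (0 < s)%N -> s = 'C(n.+1, 2) ->
  (forall x, dot x x ^+ 2 = \sum_t dot (a t) x ^+ 4) ->
  exists (b : 'I_s -> 'I_n -> K) (rho : K),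
    [/\ forall x, dot x x ^+ 2 = \sum_t dot (b t) x ^+ 4,
        3 * n.+1%:R * rho ^+ 2 = 2 * n.+2%:R,
        forall t, dot (b t) (b t) = rho &
        forall t u, t != u -> n.+2%:R * dot (b t) (b u) ^+ 2 = rho ^+ 2].
Proof.
move=> s0 sT Ha; have t0 : 'I_s by case: (s) s0 => // k _; exact: ord0.
have Q := tight_veronese_kernel Ha sT.
have n2 : 2 + n%:R != 0 :> K by rewrite -natrD pnatr_eq0.
have nrm4 t : 3 * n.+1%:R * dot (a t) (a t) ^+ 2 = 2 * n.+2%:R.
  have := Q t t; rewrite eqxx -[RHS]/(1 : K) /veronese_kernel => E.
  by rewrite -[RHS]mulr1 -E; field.
pose rho := dot (a t0) (a t0).
pose eta t : K := if dot (a t) (a t) == rho then 1 else 'i.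
have eta4 t : eta t ^+ 4 = 1.
  rewrite /eta; case: ifP => _; first exact: expr1n.
  by rewrite (exprM _ 2 2) sqrCi sqrrN expr1n.
pose b t i := eta t * a t i.
have bE x t : dot (b t) x ^+ 4 = dot (a t) x ^+ 4.
  by rewrite dotZl exprMn eta4 mul1r.
have Hb x : dot x x ^+ 2 = \sum_t dot (b t) x ^+ 4.
  by rewrite Ha; apply: eq_bigr => t _; rewrite bE.
have nb t : dot (b t) (b t) = rho.
  rewrite dotZl dotZr mulrA -expr2 /eta; case: eqP => [->|ne].
    by rewrite expr1n mul1r.
  have /eqP : dot (a t) (a t) ^+ 2 = rho ^+ 2.
    have n31 : 3 * n.+1%:R != 0 :> K by rewrite mulf_neq0 ?pnatr_eq0.
    by apply: (mulfI n31); rewrite !nrm4.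
  by rewrite eqf_sqr sqrCi => /orP[/eqP//|/eqP->]; rewrite mulN1r opprK.
exists b, rho; split=> //; first exact: nrm4.
move=> t u /negPf tu.
have := tight_veronese_kernel Hb sT t u; rewrite tu /veronese_kernel !nb => /eqP.
rewrite mulf_eq0 mulf_eq0 invr_eq0 !pnatr_eq0 /= subr_eq0 => /eqP->.
by field.
Qed.

Lemma dvdn_of_sqr_eq (a b w : nat) : (a * b ^ 2 = w ^ 2)%N -> (b %| w)%N.
Proof. by move=> E; rewrite -(@dvdn_pexp2r b w 2) // -E dvdn_mull. Qed.

(** Modulo 2 the matrix is J - I, whose square is N J - 2 J + I = I. *)
Lemma det_Seidel_neq0 (N : nat) (z : int) (S : 'M[int]_N) :
  ~~ odd N -> (2 %| z)%Z -> (forall i, S i i = 0) ->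
  (forall i j, i != j -> S i j = 1 \/ S i j = -1) ->
  \det (z%:M + S) != 0.
Proof.
move=> oN z2 S0 S1; pose f : {rmorphism int -> 'F_2} := intr.
have f2 : f 2 = 0 by apply/eqP.
have fz : f z = 0 by case/dvdzP: z2 => k ->; rewrite rmorphM f2 mulr0.
have fM : map_mx f (z%:M + S) = const_mx 1 - 1%:M.
  apply/matrixP => i j; rewrite !mxE rmorphD rmorphMn /= fz mul0rn add0r.
  case: eqVneq => [->|/S1[]->]; first by rewrite S0 rmorph0 subrr.
    by rewrite rmorph1 subr0.
  by rewrite rmorphN1; apply/eqP.
have sq : map_mx f (z%:M + S) *m map_mx f (z%:M + S) = 1%:M.
  rewrite fM mulmxBr mulmxBl !mul1mx mulmx1; apply/matrixP => i j.
  rewrite !mxE; under eq_bigr do rewrite !mxE mulr1.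
  rewrite sumr_const card_ord.
  have -> : N%:R = 0 :> 'F_2.
    by rewrite -(odd_double_half N) (negPf oN) -mul2n natrM (_ : 2 = 0) ?mul0r //;
      apply/eqP.
  by case: (i == j); apply/eqP.
apply/eqP => d0; have := congr1 determinant sq.
by rewrite det_mulmx det1 det_map_mx d0 rmorph0 mul0r => /eqP; rewrite eq_sym oner_eq0.
Qed.

(** The Gram matrix G satisfies G^2 = lambda G by [moment2_norm_polar]; its
off-diagonal entries make mu rational, and the vanishing of its minors of size
n+2 rules out an even mu. *)
Lemma tight_dim (K : numClosedFieldType) n :
  (3 < n)%N -> has_waring_decomp 4 (quad_form K n ^+ 2) 'C(n.+1, 2) ->
  exists m : nat, odd m /\ (n = m ^ 2 - 2)%N.
Proof.
move=> n3; set s := 'C(n.+1, 2) => /decomp_dot[a0 Ha0].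
have sn : (n.+2 <= s)%N.
  rewrite /s bin2 -divn2 leq_divRL // /=; nia.
have [|a [rho [Ha rho2 nrm ang]]] := normalized_tight _ erefl Ha0.
  exact: leq_trans sn.
have n2 : n.+2%:R != 0 :> K by rewrite pnatr_eq0.
have rho0 : rho != 0.
  apply: contra_eqN rho2 => /eqP->.
  by rewrite expr0n /= mulr0 eq_sym mulf_neq0 ?pnatr_eq0.
pose mu : K := sqrtC n.+2%:R.
have mu2 : mu ^+ 2 = n.+2%:R by rewrite sqrtCK.
pose S (t u : 'I_s) : int :=
  if t == u then 0 else if mu * dot (a t) (a u) == rho then 1 else -1.
have S1 t u : t != u -> S t u = 1 \/ S t u = -1.
  by rewrite /S => /negPf->; case: ifP; [left | right].
have gram t u : mu * dot (a t) (a u) = rho * ((t == u)%:R * mu + (S t u)%:~R).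
  rewrite /S; case: eqVneq => [->|tu].
    by rewrite nrm mul1r addr0 mulrC.
  rewrite mul0r add0r; case: eqP => [->|ne]; first by rewrite mulr1.
  have : (mu * dot (a t) (a u)) ^+ 2 = rho ^+ 2 by rewrite exprMn mu2 ang.
  by move/eqP; rewrite eqf_sqr => /orP[/eqP//|/eqP->]; rewrite mulrN1.
have [t0 [t1 t01]] : exists t0 t1 : 'I_s, t0 != t1.
  exists (Ordinal (leq_trans (isT : 0 < n.+2)%N sn)).
  by exists (Ordinal (leq_trans (isT : 1 < n.+2)%N sn)).
(* With Z the entry (t0, t1) of S^2, the same entry of (mu I + S)^2 is
   2 mu e + Z, which gives 2 Z = mu (n - 3) e with e = +1 or -1. *)
have [w Ew] : exists w : int, mu * (n - 3)%:R = w%:~R.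
  exists (2 * (\sum_v S t0 v * S v t1) * S t0 t1).
  pose Z : K := (\sum_v S t0 v * S v t1)%:~R.
  pose e : K := (S t0 t1)%:~R.
  have e2 : e ^+ 2 = 1 by rewrite /e; case: (S1 _ _ t01) => ->; rewrite ?sqrrN ?expr1n.
  have Zdef : \sum_v ((t0 == v)%:R * mu + (S t0 v)%:~R) *
                     ((v == t1)%:R * mu + (S v t1)%:~R) = 2 * mu * e + Z.
    under eq_bigr do rewrite mulrDl !mulrDr.
    rewrite !big_split /= (bigD1 t0) //= eqxx (negPf t01) mul0r mulr0 add0r.
    rewrite big1 ?add0r => [|v /negPf vt]; last by rewrite eq_sym vt !mul0r.
    rewrite (bigD1 t0) //= eqxx mul1r -/e big1 ?addr0 => [|v /negPf vt]; last first.
      by rewrite eq_sym vt !mul0r.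
    rewrite (bigD1 t1) //= eqxx mul1r -/e big1 ?addr0 => [|v /negPf vt]; last first.
      by rewrite vt mul0r mulr0.
    rewrite /Z rmorph_sum /=; under [in RHS]eq_bigr do rewrite rmorphM.
    by rewrite /=; ring.
  have := moment2_norm_polar Ha (a t0) (a t1) => /(congr1 ( *%R (mu ^+ 2))).
  have -> : mu ^+ 2 * (n.+2%:R * dot (a t0) (a t1)) =
            n.+2%:R * mu * (mu * dot (a t0) (a t1)) by ring.
  rewrite gram (negPf t01) mul0r add0r -/e.
  have -> : mu ^+ 2 * (3 * \sum_v dot (a v) (a v) * (dot (a v) (a t0) * dot (a v) (a t1)))
     = rho * (3 * rho ^+ 2 * (2 * mu * e + Z)).
    rewrite -Zdef !mulr_sumr; apply: eq_bigr => v _.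
    rewrite nrm (dotC (a v) (a t0)).
    transitivity (3 * rho * ((mu * dot (a t0) (a v)) * (mu * dot (a v) (a t1)))); first by ring.
    by rewrite !gram; ring.
  have -> : n.+2%:R * mu * (rho * e) = rho * (n.+2%:R * mu * e) by ring.
  move=> /(mulfI rho0)/(congr1 ( *%R n.+1%:R)).
  have -> : n.+1%:R * (3 * rho ^+ 2 * (2 * mu * e + Z)) =
    n.+2%:R * (2 * (2 * mu * e + Z)).
    transitivity (3 * n.+1%:R * rho ^+ 2 * (2 * mu * e + Z)); first by ring.
    by rewrite rho2; ring.
  have -> : n.+1%:R * (n.+2%:R * mu * e) = n.+2%:R * (n.+1%:R * mu * e) by ring.
  move=> /(mulfI n2) E.
  rewrite !rmorphM /= -/Z -/e natrB 1?ltnW //.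
  transitivity ((2 * (2 * mu * e + Z) - 4 * mu * e) * e); last by ring.
  by rewrite E; transitivity (mu * (n%:R - 3) * e ^+ 2); [rewrite e2; ring | ring].
have [zeta Ez] : exists zeta : int, mu = zeta%:~R.
  have Ew2 : (n.+2 * (n - 3) ^ 2 = `|w| ^ 2)%N.
    apply/eqP; rewrite -(eqr_nat K) natrM natrX -mu2 -exprMn Ew.
    rewrite natrX natr_absz -!rmorphXn /=.
    by apply/eqP; congr (_%:~R); rewrite !expr2; case: (w) => k; lia.
  have /dvdnP[z zE] := dvdn_of_sqr_eq Ew2.
  have n30 : (n - 3)%:R != 0 :> K by rewrite pnatr_eq0; lia.
  exists ((-1) ^+ (w < 0)%R * z%:Z); apply: (mulIf n30).
  rewrite Ew [w in LHS]intEsign zE PoszM mulrA rmorphM /=.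
  by congr (_ * _).
have zeta2 : (`|zeta| ^ 2 = n.+2)%N.
  apply/eqP; rewrite -(eqr_nat K) -mu2 Ez natrX natr_absz.
  rewrite -!rmorphXn /=.
  by apply/eqP; congr (_%:~R); rewrite !expr2; case: (zeta) => k; lia.
exists `|zeta|%N; split; last by rewrite zeta2; lia.
apply/negPn/negP => even_zeta.
(* Any n+2 of the vectors are linearly dependent, so this minor of the Gram
   matrix, rescaled to be integral, is zero. *)
pose B := \matrix_(i < n.+2, j < n.+2) S (widen_ord sn i) (widen_ord sn j).
have : \det (zeta%:M + B) != 0.
  apply: det_Seidel_neq0 => [||i|i j ij].
  - by rewrite -zeta2 oddX.
  - by rewrite dvdzE /= dvdn2.
  - by rewrite mxE /S eqxx.
  by rewrite mxE; apply: S1.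
pose A := \matrix_(i < n.+2, j < n) a (widen_ord sn i) j.
have mapB : map_mx intr (zeta%:M + B) = (mu / rho) *: (A *m A^T).
  apply/matrixP => i j; rewrite !mxE.
  under eq_bigr do rewrite !mxE.
  rewrite -/(dot _ _) mulrAC gram mulrC mulKf // rmorphD rmorphMn /= -Ez.
  by rewrite -val_eqE /= mulrC mulr_natr.
have : \det (map_mx (intr : int -> K) (zeta%:M + B)) = 0.
  rewrite mapB detZ; suff -> : \det (A *m A^T) = 0 by rewrite mulr0.
  apply/eqP; rewrite -[_ == 0]negbK -unitfE -unitmxE -row_free_unit.
  apply/negP => /eqP full; have := mxrankM_maxl A A^T.
  by rewrite full => /leq_trans/(_ (rank_leq_col A)); rewrite ltnNge leqnSn.
by rewrite det_map_mx => /eqP; rewrite intr_eq0 => ->.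
Qed.

(** * Combining sums of fourth powers *)
Section WaringAlgebra.
Variables (K : numClosedFieldType) (n : nat).
Implicit Types f g l : {mpoly K[n]}.
Local Notation quartic := (has_waring_decomp 4).

Lemma quartic_pow l : l \is 1.-homog -> quartic (l ^+ 4) 1.
Proof. by exists (fun=> l); split=> //; rewrite big_ord1. Qed.

Lemma quartic0 r : quartic (0 : {mpoly K[n]}) r.
Proof.
by exists (fun=> 0); split=> [j|]; rewrite ?dhomog0 // big1 // => j _; rewrite expr0n.
Qed.

Lemma quarticD f g r s : quartic f r -> quartic g s -> quartic (f + g) (r + s).
Proof.
move=> [l [hl ->]] [m [hm ->]].
exists (fun j => match split j with inl i => l i | inr i => m i end); split.
  by move=> j; case: split.
rewrite big_split_ord /=; congr (_ + _); apply: eq_bigr => i _.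
  by rewrite (unsplitK (inl _ i)).
by rewrite (unsplitK (inr _ i)).
Qed.

Lemma quartic_le f r s : (r <= s)%N -> quartic f r -> quartic f s.
Proof. by move=> /subnKC<- Hf; rewrite -(addr0 f); exact: quarticD (quartic0 _). Qed.

(** A scalar is absorbed into the linear forms by a fourth root; the factor
[c != 0] lets vanishing terms of a family be discounted. *)
Lemma quarticZ (c : K) f r : quartic f r -> quartic (c *: f) ((c != 0) * r).
Proof.
case: eqVneq => [-> _|_]; first by rewrite scale0r; exact: quartic0.
case=> l [hl ->]; rewrite mul1n; exists (fun j => 4.-root c *: l j).
split=> [j|]; first by rewrite rpredZ.
by rewrite scaler_sumr; apply: eq_bigr => j _; rewrite exprZn rootCK.
Qed.

Lemma quartic_sum (I : Type) (s : seq I) (P : pred I) (f : I -> {mpoly K[n]}) r :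
  (forall i, P i -> quartic (f i) (r i)) ->
  quartic (\sum_(i <- s | P i) f i) (\sum_(i <- s | P i) r i)%N.
Proof.
by move=> H; elim/big_rec2: _ => [|i g k Pi]; [exact: quartic0 | apply/quarticD/H].
Qed.

Lemma quartic_sum_pairs (f : 'I_n -> 'I_n -> {mpoly K[n]}) :
  (forall i j, f i j \is 1.-homog) ->
  quartic (\sum_(j < n) \sum_(i < n | (i < j)%N) f i j ^+ 4) 'C(n, 2).
Proof.
move=> hf; rewrite -bin2_sum big_mkord; apply: quartic_sum => j _.
have jE : (\sum_(i < n | (i < j)%N) 1 = j)%N.
  by rewrite -(big_ord_widen n (fun=> 1%N)) 1?ltnW // sum1_card card_ord.
rewrite -[X in has_waring_decomp _ _ X]jE.
by apply: quartic_sum => i _; apply: quartic_pow.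
Qed.

End WaringAlgebra.

(** * Identities invariant under permuting the variables *)
Section PowerSums.
Variables (A : comNzRingType) (n : nat) (x : 'I_n -> A).
Local Notation p k := (\sum_i x i ^+ k).
Local Notation sg := (\sum_i x i).

Lemma sum_quartic_poly (c0 c1 c2 c3 c4 : A) :
  \sum_i (c0 + c1 * x i + c2 * x i ^+ 2 + c3 * x i ^+ 3 + c4 * x i ^+ 4) =
  n%:R * c0 + c1 * sg + c2 * p 2 + c3 * p 3 + c4 * p 4.
Proof.
by rewrite !big_split /= -!mulr_sumr sumr_const card_ord mulr_natl.
Qed.

Lemma sum_shift4 (y : A) : \sum_i (x i + y) ^+ 4 =
  p 4 + 4 * y * p 3 + 6 * y ^+ 2 * p 2 + 4 * y ^+ 3 * sg + n%:R * y ^+ 4.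
Proof.
transitivity (\sum_i (y ^+ 4 + 4 * y ^+ 3 * x i + 6 * y ^+ 2 * x i ^+ 2
                      + 4 * y * x i ^+ 3 + 1 * x i ^+ 4)).
  by apply: eq_bigr => i _; ring.
by rewrite sum_quartic_poly; ring.
Qed.

Lemma sum_sym_split (f : 'I_n -> 'I_n -> A) : (forall i j, f i j = f j i) ->
  \sum_j \sum_i f i j =
  2 * (\sum_(j < n) \sum_(i < n | (i < j)%N) f i j) + \sum_i f i i.
Proof.
move=> fC; rewrite mulr2n mulrDl mul1r.
have -> : \sum_j \sum_i f i j = \sum_(j < n) \sum_(i < n | (i < j)%N) f i j +
    \sum_(j < n) \sum_(i < n | (j < i)%N) f i j + \sum_i f i i.
  rewrite -!big_split /=; apply: eq_bigr => j _.
  rewrite (bigID (fun i : 'I_n => (i < j)%N)) /= -addrA; congr (_ + _).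
  rewrite (bigD1 j) ?ltnn //= addrC; congr (_ + _); apply: eq_bigl => i.
  by rewrite -leqNgt ltn_neqAle eq_sym andbC.
congr (_ + _ + _); rewrite (exchange_big_dep predT) //=.
by apply: eq_bigr => j _; apply: eq_bigr => i _.
Qed.

(** The factor 2 avoids dividing in an arbitrary ring: the sum over unordered
pairs is half of the double sum less its diagonal. *)
Lemma sum_pairs4 (y : A) :
  2 * (\sum_(j < n) \sum_(i < n | (i < j)%N) (x i + x j + y) ^+ 4) =
  2 * ((n%:R - 8) * p 4 + 4 * (sg + (n%:R - 4) * y) * p 3 + 3 * p 2 ^+ 2
    + (12 * y * sg + 6 * (n%:R - 2) * y ^+ 2) * p 2 + 6 * y ^+ 2 * sg ^+ 2
    + 4 * (n%:R - 1) * y ^+ 3 * sg) + n%:R * (n%:R - 1) * y ^+ 4.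
Proof.
have := @sum_sym_split (fun i j => (x i + x j + y) ^+ 4) _.
move/(_ (fun i j => congr1 (fun z => (z + y) ^+ 4) (addrC (x i) (x j)))) => E.
have -> := esym (addrK (\sum_i (x i + x i + y) ^+ 4)
  (2 * \sum_(j < n) \sum_(i < n | (i < j)%N) (x i + x j + y) ^+ 4)).
rewrite -E.
have -> : \sum_i (x i + x i + y) ^+ 4 = 
   n%:R * y ^+ 4 + 8 * y ^+ 3 * sg + 24 * y ^+ 2 * p 2 + 32 * y * p 3 + 16 * p 4.
  by rewrite -sum_quartic_poly; apply: eq_bigr => i _; ring.
have -> : \sum_j \sum_i (x i + x j + y) ^+ 4 =
  n%:R * (p 4 + 4 * y * p 3 + 6 * y ^+ 2 * p 2 + 4 * y ^+ 3 * sg + n%:R * y ^+ 4)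
  + (4 * p 3 + 12 * y * p 2 + 12 * y ^+ 2 * sg + n%:R * 4 * y ^+ 3) * sg
  + (6 * p 2 + 12 * y * sg + n%:R * 6 * y ^+ 2) * p 2
  + (4 * sg + n%:R * 4 * y) * p 3 + n%:R * p 4.
  rewrite -sum_quartic_poly; apply: eq_bigr => j _.
  under eq_bigr do rewrite -addrA.
  by rewrite sum_shift4; ring.
ring.
Qed.

(** The four hypotheses cancel the coefficients of p_4, p_3 s, p_2 s^2 and s^4
in turn, where p_k is the k-th power sum and s the sum of the variables; what is
left is the term p_2^2 contributed by the pairs. Two families of forms
x_i + b s are allowed since one does not suffice when n = 8. *)
Lemma symmetric_identity (c b1 v1 b2 v2 u : A) :
  n%:R - 8 + 3 * (v1 + v2) = 0 ->
  1 + (n%:R - 4) * c + 3 * (b1 * v1 + b2 * v2) = 0 ->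
  2 * c + (n%:R - 2) * c ^+ 2 + 3 * (b1 ^+ 2 * v1 + b2 ^+ 2 * v2) = 0 ->
  12 * c ^+ 2 + 8 * (n%:R - 1) * c ^+ 3 + n%:R * (n%:R - 1) * c ^+ 4
    + 6 * (v1 * (4 * b1 ^+ 3 + n%:R * b1 ^+ 4)
         + v2 * (4 * b2 ^+ 3 + n%:R * b2 ^+ 4)) + 6 * u = 0 ->
  6 * p 2 ^+ 2 =
  2 * (\sum_(j < n) \sum_(i < n | (i < j)%N) (x i + x j + c * sg) ^+ 4)
  + 6 * v1 * (\sum_i (x i + b1 * sg) ^+ 4)
  + 6 * v2 * (\sum_i (x i + b2 * sg) ^+ 4) + 6 * u * sg ^+ 4.
Proof.
move=> H4 H3 H2 H1; rewrite sum_pairs4 !sum_shift4.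
set s1 := sg; set p2 := p 2; set p3 := p 3; set p4 := p 4; set N := n%:R in H4 H3 H2 H1 *.
rewrite -[LHS]addr0 -[X in _ + X](mulr0 (2 * p4)) -H4.
rewrite -[LHS]addr0 -[X in _ + X](mulr0 (8 * p3 * s1)) -H3.
rewrite -[LHS]addr0 -[X in _ + X](mulr0 (12 * p2 * s1 ^+ 2)) -H2.
rewrite -[LHS]addr0 -[X in _ + X](mulr0 (s1 ^+ 4)) -H1.
ring.
Qed.

End PowerSums.

(** * Decompositions for n different from 23 *)
Section UpperBounds.
Variable K : numClosedFieldType.

Lemma quartic_symmetric n (c b1 v1 b2 v2 u : K) :
  n%:R - 8 + 3 * (v1 + v2) = 0 ->
  1 + (n%:R - 4) * c + 3 * (b1 * v1 + b2 * v2) = 0 ->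
  2 * c + (n%:R - 2) * c ^+ 2 + 3 * (b1 ^+ 2 * v1 + b2 ^+ 2 * v2) = 0 ->
  12 * c ^+ 2 + 8 * (n%:R - 1) * c ^+ 3 + n%:R * (n%:R - 1) * c ^+ 4
    + 6 * (v1 * (4 * b1 ^+ 3 + n%:R * b1 ^+ 4)
         + v2 * (4 * b2 ^+ 3 + n%:R * b2 ^+ 4)) + 6 * u = 0 ->
  has_waring_decomp 4 (quad_form K n ^+ 2)
    ('C(n, 2) + (v1 != 0) * n + (v2 != 0) * n + (u != 0)).
Proof.
move=> H4 H3 H2 H1; pose X (i : 'I_n) : {mpoly K[n]} := 'X_i.
pose C (z : K) : {mpoly K[n]} := z%:MP.
have CE : [/\ C 0 = 0, C 1 = 1, {morph C : z w / z + w}, {morph C : z w / z * w}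
   & forall k : nat, C k%:R = k%:R].
  split=> [|||z w|k]; [exact: rmorph0 | exact: rmorph1 | exact: rmorphD |
                       exact: rmorphM | exact: rmorph_nat].
have CN : {morph C : z / - z} by exact: rmorphN.
have CX k : {morph C : z / z ^+ k} by move=> z; exact: rmorphXn.
case: CE => C0 C1 CD CM Cn.
pose simpC := (C0, C1, CD, CM, CN, CX, Cn).
have := @symmetric_identity _ n X (C c) (C b1) (C v1) (C b2) (C v2) (C u).
move: (congr1 C H4) (congr1 C H3) (congr1 C H2) (congr1 C H1).
rewrite !simpC => E4 E3 E2 E1 /(_ E4 E3 E2 E1) E.
have six : (6 : K) != 0 by rewrite pnatr_eq0.
have homX i : X i \is 1.-homog by rewrite dhomogX /= mdeg1.
have homC z l : l \is 1.-homog -> C z * l \is 1.-homog.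
  by move=> hl; rewrite mul_mpolyC rpredZ.
have homS : \sum_i X i \is 1.-homog by apply: rpred_sum.
have -> : quad_form K n ^+ 2 =
  (1 / 3) *: (\sum_(j < n) \sum_(i < n | (i < j)%N) (X i + X j + C c * \sum_k X k) ^+ 4)
  + v1 *: (\sum_i (X i + C b1 * \sum_k X k) ^+ 4)
  + v2 *: (\sum_i (X i + C b2 * \sum_k X k) ^+ 4) + u *: (\sum_k X k) ^+ 4.
  apply: (scalerI six); rewrite !scalerDr !scalerA.
  rewrite (_ : 6 * (1 / 3) = 2); last by field.
  by rewrite -!mul_mpolyC -!/(C _) !simpC.
have third : (1 / 3 : K) != 0 by rewrite mul1r invr_eq0 pnatr_eq0.
apply: quarticD.
  apply: quarticD.
    apply: quarticD.
      have := quarticZ (1 / 3) (quartic_sum_pairs (f := fun i j => X i + X j + C c * \sum_k X k) _).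
      by rewrite third mul1n; apply=> i j; rewrite !rpredD // homC.
    apply: quarticZ; rewrite -[X in has_waring_decomp _ _ X]card_ord -sum1_card.
    by apply: quartic_sum => i _; apply: quartic_pow; rewrite rpredD // homC.
  apply: quarticZ; rewrite -[X in has_waring_decomp _ _ X]card_ord -sum1_card.
  by apply: quartic_sum => i _; apply: quartic_pow; rewrite rpredD // homC.
by rewrite -[X in has_waring_decomp _ _ X]muln1; apply/quarticZ/quartic_pow.
Qed.

(** With a single family, the conditions on p_4 and p_3 s determine v and b, the
one on p_2 s^2 becomes 2 n c^2 + 8 c + 1 = 0, and u absorbs the last one. The
division by n - 8 is what excludes n = 8. *)
Lemma quartic_generic n : (0 < n)%N -> n != 8 ->
  has_waring_decomp 4 (quad_form K n ^+ 2) ('C(n.+1, 2) + 1).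
Proof.
move=> n0 n8; have n0K : n%:R != 0 :> K by rewrite pnatr_eq0 -lt0n.
have n8K : n%:R - 8 != 0 :> K by rewrite subr_eq0 eqr_nat.
pose c : K := (- 8 + sqrtC (64 - 8 * n%:R)) / (4 * n%:R).
pose b : K := (1 + (n%:R - 4) * c) / (n%:R - 8).
pose v : K := (8 - n%:R) / 3.
have c2 : 2 * n%:R * c ^+ 2 + 8 * c + 1 = 0.
  have := sqrtCK (64 - 8 * n%:R : K); rewrite /c.
  move: (sqrtC _) => r r2.
  transitivity ((r ^+ 2 - (64 - 8 * n%:R)) / (8 * n%:R)); first by field.
  by rewrite r2 subrr mul0r.
pose w := 12 * c ^+ 2 + 8 * (n%:R - 1) * c ^+ 3 + n%:R * (n%:R - 1) * c ^+ 4
    + 6 * (v * (4 * b ^+ 3 + n%:R * b ^+ 4)).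
have := @quartic_symmetric n c b v 0 0 (- w / 6).
rewrite eqxx mul0n addn0 => H; apply: (quartic_le _ (H _ _ _ _)).
- rewrite binS bin1 -addnA -[leqRHS]addnA leq_add2l.
  by case: eqVneq; case: eqVneq; rewrite /= ?mul0n ?mul1n; lia.
- by rewrite /v; field.
- by rewrite /v /b; field.
- transitivity (- (2 * n%:R * c ^+ 2 + 8 * c + 1) / (n%:R - 8)).
    by rewrite /v /b; field.
  by rewrite c2 oppr0 mul0r.
by rewrite /w; field.
Qed.

(** Among nine variables of zero sum, the p_4 coefficient of the pairs is
9 - 8 = 1 and is compensated by nine further fourth powers. The constants below
come from an isometry onto that hyperplane: x_i = y_i - s/12 for i <= 8 and
x_9 = - s/3, where s is the sum of the y_i. *)
Lemma quartic_dim8 : has_waring_decomp 4 (quad_form K 8 ^+ 2) ('C(9, 2) + 9).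
Proof.
have H := @quartic_symmetric 8 (- 1 / 6) (- 5 / 12) (1 / 3) (- 1 / 12) (- 1 / 3) (- 1 / 243).
apply: (quartic_le _ (H _ _ _ _)); try by field.
by case: (_ != 0); case: (_ != 0); case: (_ != 0).
Qed.

(** Among eight variables of zero sum, the pairs alone give 3 p_2^2, since the
p_4 coefficient 8 - 8 vanishes. An isometry onto that hyperplane is
x_i = y_i + c s/2 for i <= 7, with c a root of 14 c^2 + 8 c + 1; the seven pairs
containing x_8 become y_i - (1 + 3 c) s. *)
Lemma quartic_dim7 : has_waring_decomp 4 (quad_form K 7 ^+ 2) 'C(8, 2).
Proof.
pose c : K := (- 4 + sqrtC 2) / 14.
have c2 : 14 * c ^+ 2 + 8 * c + 1 = 0.
  have := sqrtCK (2 : K); rewrite /c; move: (sqrtC _) => r r2.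
  transitivity ((r ^+ 2 - 2) / 14); first by field.
  by rewrite r2 subrr mul0r.
have := @quartic_symmetric 7 c (- 1 - 3 * c) (1 / 3) 0 0 0.
rewrite eqxx mul0n !addn0 => H; apply: (quartic_le _ (H _ _ _ _)).
- by case: eqVneq.
- by field.
- by field.
- by transitivity (14 * c ^+ 2 + 8 * c + 1) => //; field.
transitivity ((14 * c ^+ 2 + 8 * c + 1) * (84 * c ^+ 2 + 48 * c + 6)); last by rewrite c2 mul0r.
by field.
Qed.

(** For the golden ratio t, the vectors (1, t, 0), (1, -t, 0) and their cyclic
shifts span the six diagonals of a regular icosahedron. *)
Lemma icosahedron_identity (A : comNzRingType) (x y z t : A) :
  t ^+ 2 = t + 1 ->
  6 * t ^+ 2 * (x ^+ 2 + y ^+ 2 + z ^+ 2) ^+ 2 =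
  (x + t * y) ^+ 4 + (x + - t * y) ^+ 4 + (y + t * z) ^+ 4 + (y + - t * z) ^+ 4
  + (z + t * x) ^+ 4 + (z + - t * x) ^+ 4.
Proof.
move=> t2; have t4 : t ^+ 4 = 3 * t ^+ 2 - 1.
  by rewrite (exprM _ 2 2) t2 sqrrD t2; ring.
transitivity (2 * (1 + t ^+ 4) * (x ^+ 4 + y ^+ 4 + z ^+ 4)
  + 12 * t ^+ 2 * (x ^+ 2 * y ^+ 2 + y ^+ 2 * z ^+ 2 + z ^+ 2 * x ^+ 2)).
  by rewrite t4; ring.
ring.
Qed.

Lemma quartic_dim3 : has_waring_decomp 4 (quad_form K 3 ^+ 2) 'C(4, 2).
Proof.
pose t : K := (1 + sqrtC 5) / 2.
have t2 : t ^+ 2 = t + 1.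
  have := sqrtCK (5 : K); rewrite /t; move: (sqrtC _) => r r2.
  apply/eqP; rewrite -subr_eq0; apply/eqP.
  transitivity ((r ^+ 2 - 5) / 4); first by field.
  by rewrite r2 subrr mul0r.
have t0 : 6 * t ^+ 2 != 0.
  rewrite mulf_neq0 ?pnatr_eq0 // expf_neq0 //; apply/eqP => t0.
  by move/eqP: t2; rewrite t0 expr0n add0r eq_sym oner_eq0.
pose X (i : 'I_3) : {mpoly K[3]} := 'X_i.
have t2P : (t%:MP : {mpoly K[3]}) ^+ 2 = t%:MP + 1.
  by rewrite -rmorphXn t2 rmorphD rmorph1.
have E := icosahedron_identity (X 0) (X 1) (X 2%R) t2P.
have qE : quad_form K 3 = X 0 ^+ 2 + X 1 ^+ 2 + X 2%R ^+ 2.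
  rewrite /quad_form !big_ord_recl big_ord0 addr0 addrA.
  by congr (_ + 'X_ _ ^+ _ + 'X_ _ ^+ _); apply: val_inj.
have hom i j (e : K) : X i + e%:MP * X j \is 1.-homog.
  by rewrite mul_mpolyC rpredD ?rpredZ // dhomogX /= mdeg1.
have -> : quad_form K 3 ^+ 2 = (6 * t ^+ 2)^-1 *: (6 * t%:MP ^+ 2 * quad_form K 3 ^+ 2).
  have -> : 6 * t%:MP ^+ 2 = (6 * t ^+ 2)%:MP :> {mpoly K[3]}.
    have six : 6%:MP = 6 :> {mpoly K[3]} by exact: rmorph_nat.
    by rewrite !expr2 !mpolyCM six.
  rewrite mul_mpolyC scalerA mulVf //.
  by rewrite scale1r.
rewrite qE E; have -> : - t%:MP = (- t)%:MP :> {mpoly K[3]} by rewrite rmorphN.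
have := @quarticZ K 3 (6 * t ^+ 2)^-1 _ (1 + 1 + 1 + 1 + 1 + 1)%N.
rewrite invr_eq0 t0; apply.
by do !apply: quarticD; apply: quartic_pow.
Qed.

End UpperBounds.

(** * Equiangular systems of maximal size *)
Section Equiangular.
Variables (K : numClosedFieldType) (n : nat) (I : finType) (a : I -> 'I_n -> K).
Hypothesis card_I : #|I| = 'C(n.+1, 2).
Local Notation nrm s := (dot (a s) (a s)).
Hypothesis nrm_neq0 : forall s, nrm s != 0.
Hypothesis equiangular : forall s t, s != t ->
  n.+2%:R * dot (a s) (a t) ^+ 2 = nrm s * nrm t.

Local Notation pair := ('I_n * 'I_n)%type.
Implicit Types (p q : pair).

(** The squares (a_s.x)^2 correspond to the symmetric tensors [V s]; [P s] is the
   dual family for the standard form on tensors, and [Sym] is the projection of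
   tensors onto symmetric tensors. *)
Let wt s := n.+2%:R / (n.+1%:R * nrm s ^+ 2).
Let V s p := a s p.1 * a s p.2.
Let P s p := wt s * (V s p - nrm s / n.+2%:R * (p.1 == p.2)%:R).
Let swap p : pair := (p.2, p.1).
Let Sym p q : K := ((q == p)%:R + (q == swap p)%:R) / 2.
Let E p q := \sum_s P s p * V s q.

Let n2 : n.+2%:R != 0 :> K. Proof. by rewrite pnatr_eq0. Qed.

Lemma sum_pair (A : nmodType) (g : pair -> A) :
  \sum_p g p = \sum_i \sum_j g (i, j).
Proof. by rewrite pair_bigA; apply: eq_bigr => -[]. Qed.

Lemma sum_pair_sqr (x y : 'I_n -> K) :
  \sum_p (x p.1 * x p.2) * (y p.1 * y p.2) = dot x y ^+ 2.
Proof.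
rewrite sum_pair /= expr2 {1}/dot.
rewrite mulr_suml; apply: eq_bigr => i _; rewrite mulr_sumr.
by apply: eq_bigr => j _; rewrite mulrACA.
Qed.

Lemma sum_pair_diag (A : nmodType) (g : pair -> A) :
  \sum_p g p *+ (p.1 == p.2) = \sum_i g (i, i).
Proof.
rewrite sum_pair /=.
apply: eq_bigr => i _; rewrite (bigD1 i) //= eqxx big1 ?addr0 // => j /negPf.
by rewrite eq_sym => ->.
Qed.

(** Subtracting the multiple N(a_s)/(n+2) of the identity from the tensor of a_s
is what turns the equiangular condition into orthogonality. *)
Lemma dual_basis s t : \sum_p P s p * V t p = (s == t)%:R.
Proof.
transitivity (wt s * (dot (a s) (a t) ^+ 2 - nrm s / n.+2%:R * nrm t)).
  have -> : nrm t = \sum_p (a t p.1 * a t p.2) *+ (p.1 == p.2) by rewrite sum_pair_diag.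
  rewrite -sum_pair_sqr.
  rewrite mulr_sumr -sumrB mulr_sumr; apply: eq_bigr => p _.
  by rewrite /P /V -(mulr_natr (_ * _)); ring.
rewrite /wt; case: eqVneq => [<-|/equiangular st].
  by rewrite -[RHS]/(1 : K); field; rewrite nrm_neq0 -natrD nat1r !pnatr_eq0.
have -> : dot (a s) (a t) ^+ 2 = nrm s * nrm t / n.+2%:R.
  by rewrite -st mulrC mulKf.
by rewrite [nrm s * nrm t / _]mulrAC subrr mulr0.
Qed.

Lemma sum_Sym p (g : pair -> K) : \sum_q Sym p q * g q = (g p + g (swap p)) / 2.
Proof.
rewrite /Sym; under eq_bigr do rewrite mulrAC mulrDl mulrDl.
rewrite big_split /= (bigD1 p) //= eqxx mul1r big1 => [|q /negPf->]; last by rewrite !mul0r.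
rewrite (bigD1 (swap p)) //= eqxx mul1r big1 => [|q /negPf->]; last by rewrite !mul0r.
by rewrite !addr0 -mulrDl.
Qed.

(** By [dual_basis], E is an idempotent of trace #|I| = T, and Sym is
neutral for E on both sides. Hence Sym - E is an idempotent, of trace T - T = 0. *)
Lemma veronese_resolution p q : E p q = Sym p q.
Proof.
have SymC p' q' : Sym p' q' = Sym q' p'.
  rewrite /Sym eq_sym; congr ((_ + _%:R) / 2).
  by case: p' q' => [i j] [k l]; rewrite /swap !xpair_eqE andbC (eq_sym l) (eq_sym k).
have Vs s p' : V s (swap p') = V s p' by rewrite /V mulrC.
have Ps s p' : P s (swap p') = P s p' by rewrite /P Vs /= eq_sym.
have half (x : K) : (x + x) / 2 = x by field.
have SE p' q' : \sum_t Sym p' t * E t q' = E p' q'.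
  rewrite sum_Sym -[RHS]half; congr ((_ + _) / 2).
  by apply: eq_bigr => s _; rewrite Ps.
have ES p' q' : \sum_t E p' t * Sym t q' = E p' q'.
  under eq_bigr do rewrite SymC mulrC.
  rewrite sum_Sym -[RHS]half; congr ((_ + _) / 2).
  by apply: eq_bigr => s _; rewrite Vs.
have EE p' q' : \sum_t E p' t * E t q' = E p' q'.
  under eq_bigr do rewrite mulr_suml.
  rewrite exchange_big; apply: eq_bigr => s _ /=.
  under eq_bigr do rewrite -mulrA mulr_sumr.
  rewrite -mulr_sumr exchange_big; congr (_ * _) => /=.
  under eq_bigr => u _.
    under eq_bigr do rewrite mulrA (mulrC (V s _)).
    rewrite -mulr_suml dual_basis; over.
  rewrite (bigD1 s) //= eqxx mul1r big1 ?addr0 // => u /negPf->.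
  by rewrite mul0r.
have SS p' q' : \sum_t Sym p' t * Sym t q' = Sym p' q'.
  rewrite sum_Sym -[RHS]half; congr ((_ + _) / 2).
  by case: p' q' => [i j] [k l]; rewrite /Sym /swap /= addrC.
pose f p q := Sym p q - E p q.
have ff p' q' : \sum_t f p' t * f t q' = f p' q'.
  under eq_bigr do rewrite /f mulrBl !mulrBr.
  by rewrite !sumrB SS SE ES EE /f subrr subr0.
have [r [_ tr f0]] := kernel_trace_rank ff.
apply/eqP; rewrite eq_sym -subr_eq0; apply/eqP/f0/eqP.
rewrite -(eqr_nat K) -tr /f sumrB.
have -> : \sum_p E p p = 'C(n.+1, 2)%:R.
  rewrite exchange_big -card_I -sumr_const; apply: eq_bigr => s _ /=.
  by rewrite dual_basis eqxx.
suff -> : \sum_p Sym p p = 'C(n.+1, 2)%:R by rewrite subrr.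
rewrite /Sym -mulr_suml big_split /=.
under eq_bigr do rewrite eqxx.
rewrite sumr_const card_prod card_ord.
have -> : \sum_p (p == swap p)%:R = n%:R :> K.
  rewrite -[n in RHS]card_ord -sumr_const -(sum_pair_diag (fun=> 1)).
  apply: eq_bigr => -[i j] _; rewrite /swap xpair_eqE eq_sym andbb eq_sym.
  by case: (j == i).
have two : (2 : K) != 0 by rewrite pnatr_eq0.
apply: (mulIf two); rewrite divfK // -natrM -natrD; congr (_%:R).
by rewrite bin2 muln2 -[X in X.*2]/(_./2) even_halfK ?oddM ?andNb //=; lia.
Qed.

(** [veronese_resolution] expresses each X_i X_j through the squares l_s^2.
Applied to q it gives q as a combination of the N(a_s) l_s^2; applied to one
factor of each term of q^2, the sum of the (X_i X_j)(X_i X_j), it gives l_s^4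
together with a multiple of N(a_s) l_s^2 q, which the first formula evaluates. *)
Lemma equiangular_decomp :
  has_waring_decomp 4 (quad_form K n ^+ 2) 'C(n.+1, 2).
Proof.
pose l s : {mpoly K[n]} := lform (a s).
have lsqr s : l s ^+ 2 = \sum_p V s p *: ('X_p.1 * 'X_p.2).
  rewrite sum_pair /=.
  rewrite expr2 {1}/l /lform mulr_suml; apply: eq_bigr => i _.
  rewrite mulr_sumr; apply: eq_bigr => j _.
  by rewrite -scalerAl -scalerAr scalerA.
have basis p : 'X_p.1 * 'X_p.2 = \sum_s P s p *: l s ^+ 2.
  transitivity (\sum_q Sym p q *: ('X_q.1 * 'X_q.2 : {mpoly K[n]})).
    rewrite /Sym; under eq_bigr do rewrite mulrDl scalerDl.
    rewrite big_split /= (bigD1 p) //= eqxx mul1r big1 => [|q /negPf->]; last by rewrite mul0r scale0r.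
    rewrite (bigD1 (swap p)) //= eqxx mul1r big1 => [|q /negPf->]; last by rewrite mul0r scale0r.
    rewrite !addr0 ['X_p.2 * _]mulrC -scalerDl (_ : 2^-1 + 2^-1 = 1) ?scale1r //.
    by field.
  under eq_bigr do rewrite -veronese_resolution scaler_suml.
  rewrite exchange_big; apply: eq_bigr => s _ /=.
  by rewrite lsqr scaler_sumr; apply: eq_bigr => q _; rewrite scalerA.
pose q := quad_form K n.
have q1 : q = \sum_s (2 * wt s * nrm s / n.+2%:R) *: l s ^+ 2.
  have -> : q = \sum_(i < n) 'X_(i, i).1 * 'X_(i, i).2 by [].
  under eq_bigr do rewrite basis.
  rewrite exchange_big; apply: eq_bigr => s _ /=; rewrite -scaler_suml; congr (_ *: _).
  rewrite /P /V /= -mulr_sumr sumrB -/(dot _ _).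
  under eq_bigr do rewrite eqxx mulr1.
  rewrite sumr_const card_ord.
  by rewrite -mulr_natr; field; rewrite -natrD pnatr_eq0.
have q2 : q ^+ 2 = \sum_s wt s *: (l s ^+ 4 - (nrm s / n.+2%:R) *: (l s ^+ 2 * q)).
  transitivity (\sum_p ('X_p.1 * 'X_p.2) * ('X_p.1 * 'X_p.2 : {mpoly K[n]})).
    rewrite sum_pair /=.
    rewrite expr2 {1}/q /quad_form mulr_suml; apply: eq_bigr => i _.
    by rewrite mulr_sumr; apply: eq_bigr => j _; rewrite !expr2 mulrACA.
  under eq_bigr do rewrite [X in X * _]basis mulr_suml.
  rewrite exchange_big; apply: eq_bigr => s _ /=.
  have -> : l s ^+ 4 = l s ^+ 2 * \sum_p V s p *: ('X_p.1 * 'X_p.2) by rewrite -lsqr -exprD.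
  have -> : q = \sum_p ('X_p.1 * 'X_p.2) *+ (p.1 == p.2).
    by rewrite (sum_pair_diag (fun p => 'X_p.1 * 'X_p.2)).
  rewrite scalerAr -mulrBr scalerAr scaler_sumr -sumrB scaler_sumr mulr_sumr.
  apply: eq_bigr => p _; rewrite -scalerAl scalerAr; congr (_ * _).
  by rewrite /P -scaler_nat scalerA -scalerBl scalerA.
have -> : q ^+ 2 = \sum_s (2 / 3 * wt s) *: l s ^+ 4.
  have three : (3 / 2 : K) != 0 by rewrite mulf_neq0 ?invr_eq0 ?pnatr_eq0.
  apply: (scalerI three); rewrite (_ : 3 / 2 = 1 + 1 / 2); last by field.
  have q2' : q ^+ 2 = \sum_s (2 * wt s * nrm s / n.+2%:R) *: (l s ^+ 2 * q).
    by rewrite expr2 {1}q1 mulr_suml; apply: eq_bigr => s _; rewrite -scalerAl.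
  rewrite scalerDl scale1r {1}q2 q2' !scaler_sumr -big_split /=.
  apply: eq_bigr => s _; rewrite scalerBr !scalerA.
  rewrite (_ : (1 + 1 / 2) * (2 / 3 * wt s) = wt s); last by field.
  rewrite -addrA -[RHS]addr0; congr (_ + _).
  rewrite (_ : 1 / 2 * (2 * wt s * nrm s / n.+2%:R) = wt s * (nrm s / n.+2%:R)) ?addNr //.
  by field; rewrite -natrD pnatr_eq0.
rewrite -card_I -sum1_card; apply: quartic_sum => s _.
apply: (quartic_le _ (quarticZ _ (quartic_pow _))); last exact: lform_homog.
by case: eqVneq.
Qed.

End Equiangular.

(** * The Witt design and dimension 23 *)

(** Representatives, under cyclic shift of the 23 coordinates, of the words of
weight 7 in the binary Golay code of length 23; their supports are the blocks of
S(4,7,23). *)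
Definition witt_base_blocks : seq (seq nat) :=
  [:: [:: 0; 2; 4; 5; 6; 10; 11]; [:: 0; 1; 3; 6; 8; 10; 13];
      [:: 0; 3; 9; 10; 11; 12; 14]; [:: 0; 1; 4; 5; 7; 8; 15];
      [:: 0; 2; 3; 7; 11; 13; 15]; [:: 0; 2; 7; 8; 10; 14; 16];
      [:: 0; 1; 6; 11; 14; 15; 16]; [:: 0; 1; 4; 6; 9; 12; 17];
      [:: 0; 4; 8; 11; 13; 14; 17]; [:: 0; 5; 6; 7; 13; 16; 17];
      [:: 0; 2; 6; 9; 13; 14; 18]]%N.

Definition witt_blocks : seq bitseq :=
  [seq rot k (mkseq (fun i => i \in B) 23) | B <- witt_base_blocks, k <- iota 0 23].

Definition meet_size (u v : bitseq) : nat :=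
  count (fun xy => xy.1 && xy.2) (zip u v).

Lemma witt_blocks_check :
  [&& size witt_blocks == 253%N,
      all (fun u => (size u == 23%N) && (meet_size u u == 7%N)) witt_blocks &
      pairwise (fun u v => meet_size u v \in [:: 1; 3]%N) witt_blocks].
Proof. by vm_compute. Qed.

Lemma meet_sizeE (N : nat) (u v : bitseq) : size u = N -> size v = N ->
  meet_size u v = (\sum_(i < N) (nth false u i && nth false v i))%N.
Proof.
move=> uN vN; rewrite /meet_size -sum1_count (big_nth (false, false)) size_zip uN vN minnn.
rewrite big_mkord big_mkcond /=; apply: eq_bigr => i _.
by rewrite nth_zip ?uN ?vN //=; case: (_ && _).
Qed.

Lemma meet_sizeC u v : meet_size u v = meet_size v u.
Proof.
by elim: u v => [|x u IH] [|y v] //; rewrite /meet_size /= andbC; congr addn; apply: IH.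
Qed.

Section Dim23.
Variable K : numClosedFieldType.

Definition witt_block (B : 'I_253) : bitseq := nth [::] witt_blocks B.

Let block_size B : size (witt_block B) = 23%N.
Proof.
have /and3P[/eqP s /allP al _] := witt_blocks_check.
by have /andP[/eqP] := al _ (mem_nth [::] (eq_ind_r (fun z => B < z)%N (ltn_ord B) s)).
Qed.

Let block_meet_self B : meet_size (witt_block B) (witt_block B) = 7%N.
Proof.
have /and3P[/eqP s /allP al _] := witt_blocks_check.
by have /andP[_ /eqP] := al _ (mem_nth [::] (eq_ind_r (fun z => B < z)%N (ltn_ord B) s)).
Qed.

Let block_meet B C : B != C ->
  meet_size (witt_block B) (witt_block C) = 1%N \/
  meet_size (witt_block B) (witt_block C) = 3%N.
Proof.
wlog BC : B C / (B < C)%N => [H BneC|_].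
  have [BC|CB|/val_inj/eqP] := ltngtP B C; last by rewrite (negPf BneC).
    exact: H.
  by rewrite meet_sizeC; apply: H => //; rewrite eq_sym.
have /and3P[/eqP s _ /(pairwiseP [::]) pw] := witt_blocks_check.
have := pw B C; rewrite !inE s => /(_ (ltn_ord B) (ltn_ord C) BC).
by move=> /orP[]/eqP; [left | right].
Qed.

Definition shifted (u : 'I_23 -> bool) (h : K) : 'I_23 -> K :=
  fun i => (u i)%:R + h.

Lemma dot_shifted u v g h : dot (shifted u g) (shifted v h) =
  (\sum_i (u i && v i))%N%:R + g * (\sum_i (v i && v i))%N%:R
  + h * (\sum_i (u i && u i))%N%:R + 23 * (g * h).
Proof.
rewrite !natr_sum !mulr_sumr -!big_split.
have -> : 23 * (g * h) = \sum_(i < 23) g * h.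
  by rewrite sumr_const card_ord mulr_natl.
rewrite -big_split; apply: eq_bigr => i _ /=; rewrite /shifted.
by case: (u i); case: (v i); rewrite /=; ring.
Qed.

(** The shifts b and c solve hb, hc and hbc in the proof. With hc two distinct
blocks have inner product 1 - 2 or 3 - 2, and with hbc a point and a block have
inner product -1/2 or 1/2: in each case the square does not depend on the
incidence. *)
Lemma quartic_dim23 : has_waring_decomp 4 (quad_form K 23 ^+ 2) 'C(24, 2).
Proof.
pose r : K := sqrtC 3; have r2 : r ^+ 2 = 3 by rewrite sqrtCK.
clearbody r.
pose b : K := (- 2 - 3 * r) / 46; pose c : K := (- 7 + r) / 23.
pose ind (s : 'I_23 + 'I_253) (i : 'I_23) : bool :=
  match s with inl k => i == k | inr B => nth false (witt_block B) i end.
pose a s := shifted (ind s) (if s is inl _ then b else c).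
have one k (u : pred 'I_23) : (\sum_i ((i == k) && u i))%N = u k :> nat.
  rewrite (bigD1 k) //= eqxx big1 ?addn0 // => i /negPf->//.
have EB B C : (\sum_i (ind (inr B) i && ind (inr C) i))%N =
    meet_size (witt_block B) (witt_block C).
  by rewrite (meet_sizeE (block_size B) (block_size C)).
have EE k l : (\sum_i (ind (inl k) i && ind (inl l) i))%N = (k == l) by exact: one.
have EM k B : (\sum_i (ind (inl k) i && ind (inr B) i))%N = ind (inr B) k by exact: one.
have hb : 2 * b + 23 * b ^+ 2 = 1 / 4.
  rewrite /b; transitivity ((- 4 + 9 * r ^+ 2) / 92); first by field.
  by rewrite r2; field.
have hc : 14 * c + 23 * c ^+ 2 = - 2.
  rewrite /c; transitivity ((r ^+ 2 - 49) / 23); first by field.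
  by rewrite r2; field.
have hbc : c + 7 * b + 23 * (b * c) = - 1 / 2.
  rewrite /b /c; transitivity ((- 14 - 3 * r ^+ 2) / 46); first by field.
  by rewrite r2; field.
have F0 : (false : nat)%:R = 0 :> K by [].
have T1 : (true : nat)%:R = 1 :> K by [].
clearbody b c.
have dotE k l : dot (a (inl k)) (a (inl l)) = (k == l)%:R + 1 / 4.
  by rewrite dot_shifted !EE !eqxx T1 -hb; ring.
have dotB B C : dot (a (inr B)) (a (inr C)) = (meet_size (witt_block B) (witt_block C))%:R - 2.
  by rewrite dot_shifted !EB !block_meet_self -hc; ring.
have dotM k B : dot (a (inl k)) (a (inr B)) = (ind (inr B) k)%:R - 1 / 2.
  by rewrite dot_shifted EM EE eqxx T1 EB block_meet_self -mulNr -hbc; ring.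
have nrmE k : dot (a (inl k)) (a (inl k)) = 5 / 4 by rewrite dotE eqxx /=; field.
have nrmB B : dot (a (inr B)) (a (inr B)) = 5 by rewrite dotB block_meet_self; ring.
apply: (@equiangular_decomp K 23 ('I_23 + 'I_253)%type a).
- by rewrite card_sum !card_ord.
- by case=> [k|B]; rewrite ?nrmE ?nrmB ?mulf_neq0 ?invr_eq0 ?pnatr_eq0.
move=> [k|B] [l|C]; rewrite ?nrmE ?nrmB.
- move=> kl; have /negPf kl' : k != l by [].
  by rewrite dotE kl' F0; field.
- by move=> _; rewrite dotM; case: (ind _ _); rewrite ?T1 ?F0; field.
- by move=> _; rewrite dotC dotM; case: (ind _ _); rewrite ?T1 ?F0; field.
move=> BC; rewrite dotB.
have /block_meet BC' : B != C by [].
by case: BC' => ->; ring.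
Qed.

End Dim23.

Theorem theorem5p18 (R : realType) (n : nat) (hn : (3 <= n)%N) :
  let rk_is := is_waring_rank 4 (quad_form R[i] n ^+ 2) in
  let T := 'C(n.+1, 2) in
  let case1 := n = 3%N \/ n = 7%N \/ n = 23%N in
  let case2 := n = 8%N in
  let case3 :=
    (23 < n)%N /\ (exists m : nat, odd m /\ n = (m ^ 2 - 2)%N) in
  (case1 -> rk_is T) /\
  (case2 -> exists r : nat, rk_is r /\ (T + 1 <= r <= T + 9)%N) /\
  (case3 -> exists r : nat, rk_is r /\ (T <= r <= T + 1)%N) /\
  (~ case1 -> ~ case2 -> ~ case3 -> rk_is (T + 1)%N).
Proof.
move=> rk_is T case1 case2 case3.
pose D := has_waring_decomp 4 (quad_form R[i] n ^+ 2).
have lower s : D s -> (T <= s)%N.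
  by move=> /decomp_dot[a design]; exact: binomial_le_size design.
have strict s : ~ case1 -> ~ case3 -> D s -> (T + 1 <= s)%N.
  move=> N1 N3 Ds; rewrite addn1 ltn_neqAle lower // andbT.
  apply/eqP => Ts; rewrite -Ts in Ds.
  have n3 : (3 < n)%N by rewrite ltn_neqAle hn andbT; apply/eqP => n3; apply: N1; left.
  have [m [om nm]] := tight_dim n3 Ds.
  case: (leqP n 23) => n23; last by apply: N3; split=> //; exists m.
  have m5 : (m <= 5)%N by rewrite leqNgt; apply/negP => m5; nia.
  apply: N1; right; rewrite nm.
  case: m om m5 nm => [|[|[|[|[|[|]]]]]] //= _ _ nm; last by right.
    by rewrite nm in hn.
  by left.
have generic : n != 8%N -> D (T + 1)%N.
  by move=> n8; apply: quartic_generic => //; apply: leq_trans hn.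
split; first move=> c1.
  split; last exact: lower.
  by case: c1 => [E|[E|E]]; rewrite /T E;
    [exact: quartic_dim3 | exact: quartic_dim7 | exact: quartic_dim23].
split; last split.
- move=> n8; have N1 : ~ case1 by rewrite /case1 n8; case=> [|[]].
  have N3 : ~ case3 by rewrite /case3 n8; case.
  have D9 : D (T + 9)%N by rewrite /D /T n8; exact: quartic_dim8.
  have exD : exists r, `[< D r >] by exists (T + 9)%N; apply/asboolP.
  case: (ex_minnP exD) => r /asboolP Dr rmin; exists r; split; last first.
    by rewrite strict //=; apply/rmin/asboolP.
  by split=> // s Ds; apply/rmin/asboolP.
- move=> [n23 _]; have D1 : D (T + 1)%N.
    by apply: generic; apply/eqP => n8; rewrite n8 in n23.
  have [DT|NDT] := pselect (D T).
    by exists T; split; [split | rewrite leqnn leq_addr].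
  exists (T + 1)%N; split; last by rewrite leq_addr leqnn.
  split=> // s Ds; rewrite addn1 ltn_neqAle lower // andbT.
  by apply/eqP => Ts; rewrite -Ts in Ds.
move=> N1 N2 N3; split; first by apply: generic; apply/eqP.
by move=> s; exact: strict.
Qed.
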